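(* For all integers $n\ge 0$ and all integers $k\ge j\ge 0$, \[ a_{3(k-j)+3,\;3k+6}(3n+1)\equiv a_{3(k-j)+3,\;3k+6}(3n+2)\equiv 0 \pmod 3. \]
   Context: For positive integers $r,s$, $a_{r,s}(n)$ denotes the number of multicolored partitions of $n$ in which each even part may appear in one of $r$ colors and each odd part may appear in one of $s$ colors (copies of the same part size in different colors are distinct), with $a_{r,s}(0)=1$. Equivalently, for $|q|<1$, $\sum_{n\ge0}a_{r,s}(n)q^n = f_2^{s-r}/f_1^{s}$, where $f_m=\prod_{i\ge1}(1-q^{mi})$. *)

(* Defs.v *)
From mathcomp Require Import all_boot.

Set Implicit Arguments.
Unset Strict Implicit.
Unset Printing Implicit Defensive.

Definition num_colors (r s i : nat) : nat := if odd i then s else r.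

(* The parts that can occur in a partition of n: the index i : 'I_n stands for
   the part size i.+1, so that sizes range over 1, ..., n. *)
Definition colored_part (r s n : nat) : finType :=
  {i : 'I_n & 'I_(num_colors r s i.+1)}.

Definition part_size (r s n : nat) (p : colored_part r s n) : nat :=
  (tag p).+1.

(* A multicolored partition of n is a multiset of colored parts, given by its
   multiplicities; no multiplicity can exceed n. *)
Definition colored_partitions (r s n : nat) :
    {set {ffun colored_part r s n -> 'I_n.+1}} :=
  [set m : {ffun colored_part r s n -> 'I_n.+1} |
    \sum_p m p * part_size p == n].

Definition a (r s n : nat) : nat := #|colored_partitions r s n|.

(* Main.v *)
Require Import Defs.
From mathcomp Require Import all_boot fingroup perm zify.

(** Summing the sizes of all parts of all multicolored partitions of [N] gives
    [N * a r s N]. Exchanging two colors of the same part size shows that all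
    colors of a given size contribute equally to this double count, so the
    contribution of a size is divisible by its number of colors, which is [r]
    or [s]. Hence [gcdn r s] divides [N * a r s N], and a common divisor of [r]
    and [s] that is coprime to [N] divides [a r s N]. *)

Lemma dvdn_card_sum_constant (T : finType) (F : T -> nat) :
  (forall x y, F x = F y) -> #|T| %| \sum_x F x.
Proof.
move=> F_const; case: (pickP T) => [x0 _ | T0]; last by rewrite big_pred0.
by under eq_bigr do rewrite (F_const _ x0); rewrite sum_nat_const dvdn_mulr.
Qed.

Section TotalMultiplicity.

Variables r s N : nat.

Local Notation part := (colored_part r s N).
Local Notation partitions := (colored_partitions r s N).

Definition total_multiplicity (p : part) : nat := \sum_(m in partitions) m p.

Definition permute_parts (t : {perm part}) (m : {ffun part -> 'I_N.+1}) :
  {ffun part -> 'I_N.+1} := [ffun p => m (t p)].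

Lemma permute_parts_bij t : bijective (permute_parts t).
Proof.
by exists (permute_parts t^-1) => m; apply/ffunP => p;
  rewrite !ffunE ?permK ?permKV.
Qed.

Lemma permute_parts_partitions (t : {perm part}) m :
  (forall p, part_size (t p) = part_size p) ->
  (permute_parts t m \in partitions) = (m \in partitions).
Proof.
move=> size_t; rewrite !inE [in RHS](reindex_inj (@perm_inj _ t)) /=.
by under eq_bigr do rewrite ffunE -size_t.
Qed.

Lemma eq_total_multiplicity (p q : part) :
  part_size p = part_size q -> total_multiplicity p = total_multiplicity q.
Proof.
move=> size_pq.
have size_swap x : part_size (tperm p q x) = part_size x.
  by case: tpermP => [-> | -> |].
rewrite /total_multiplicity.
rewrite (reindex _ (onW_bij _ (permute_parts_bij (tperm p q)))).
by apply: eq_big => m; rewrite ?permute_parts_partitions // ffunE tpermL.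
Qed.

Lemma sum_total_multiplicity :
  \sum_p total_multiplicity p * part_size p = N * a r s N.
Proof.
under eq_bigr do rewrite big_distrl.
rewrite exchange_big mulnC -sum_nat_const /=.
by apply: eq_bigr => m; rewrite inE => /eqP.
Qed.

Lemma dvdn_gcd_num_colors i : gcdn r s %| num_colors r s i.
Proof. by rewrite /num_colors; case: ifP; rewrite ?dvdn_gcdl ?dvdn_gcdr. Qed.

Lemma dvdn_gcd_mul_a : gcdn r s %| N * a r s N.
Proof.
pose part_of (i : 'I_N) (c : 'I_(num_colors r s i.+1)) : part := existT _ i c.
have -> : N * a r s N = \sum_i \sum_c
    total_multiplicity (part_of i c) * part_size (part_of i c).
  by rewrite -sum_total_multiplicity sig_big_dep; apply: eq_bigr => -[].
apply: dvdn_sum => i _; apply: dvdn_trans (dvdn_gcd_num_colors i.+1) _.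
rewrite -[X in X %| _]card_ord; apply: dvdn_card_sum_constant => c c'.
by rewrite (@eq_total_multiplicity _ (part_of i c')).
Qed.

Lemma coprime_dvdn_a d :
  d %| r -> d %| s -> coprime d N -> d %| a r s N.
Proof.
move=> dr ds dN; rewrite -(Gauss_dvdr _ dN).
by apply: dvdn_trans dvdn_gcd_mul_a; rewrite dvdn_gcd dr.
Qed.

End TotalMultiplicity.

Theorem theorem1p6 (n k j : nat) (hjk : j <= k) :
  a (3 * (k - j) + 3) (3 * k + 6) (3 * n + 1) = 0 %[mod 3] /\
  a (3 * (k - j) + 3) (3 * k + 6) (3 * n + 2) = 0 %[mod 3].
Proof.
by split; apply/eqP; rewrite mod0n; apply: coprime_dvdn_a;
  rewrite ?prime_coprime //; lia.
Qed.
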